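(* For every $s\ge0$, $$\lim_{n\to\infty}\bar{\mathbb{B}}_n^{-1}\bigl(p_s^{(n)}\bigr)=p_s^*\qquad\text{and}\qquad\lim_{n\to\infty}F_n\bigl(p_s^{(n)}\bigr)=p_s^* .$$
   Context: $\Pi_n$ is the space of polynomials of degree at most $n$. The Bernstein operator is $B_n(f;x)=\sum_{k=0}^n f(k/n)\binom nk x^k(1-x)^{n-k}$. The genuine Beta operator $\bar{\mathbb{B}}_n:C[0,1]\to C[0,1]$ is defined by $\bar{\mathbb{B}}_n(f;0)=f(0)$, $\bar{\mathbb{B}}_n(f;1)=f(1)$, and for $x\in(0,1)$ $$\bar{\mathbb{B}}_n(f;x)=\frac{1}{B(nx,n(1-x))}\int_0^1 t^{nx-1}(1-t)^{n(1-x)-1}f(t)\,dt,$$ where $B(\cdot,\cdot)$ is the Euler Beta function. $\bar{\mathbb{B}}_n$ restricts to a bijection $\Pi_n\to\Pi_n$, with inverse $\bar{\mathbb{B}}_n^{-1}$, and $F_n:=\bar{\mathbb{B}}_n^{-1}\circ B_n:C[0,1]\to\Pi_n$. The monic eigenpolynomials of $B_n$ are $p_0^{(n)}=1$, $p_1^{(n)}=x-\frac12$, and for $2\le k\le n$ the monic polynomial $p_k^{(n)}$ of degree $k$ with $B_np_k^{(n)}=\lambda_k^{(n)}p_k^{(n)}$, $\lambda_k^{(n)}=\frac{n!}{(n-k)!\,n^k}$. $p_k^*:=\lim_{n\to\infty}p_k^{(n)}$ (uniformly on $[0,1]$), which is known (Cooper and Waldron) to exist, with $p_0^*=1$, $p_1^*=x-\frac12$,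 $p_k^*(x)=\frac{k!(k-2)!}{(2k-2)!}x(x-1)P_{k-2}^{(1,1)}(2x-1)$ for $k\ge2$, $P_m^{(1,1)}$ being the Jacobi polynomials on $[-1,1]$ in standard normalization. All limits are uniform on $[0,1]$ (equivalently, coefficientwise), for fixed $s$ and $n\ge s$. *)

(* Defs.v *)
From HB Require Import structures.
From mathcomp Require Export all_boot all_order all_algebra.
From mathcomp Require Export all_classical all_reals all_analysis.

Set Implicit Arguments.
Unset Strict Implicit.
Unset Printing Implicit Defensive.

Import Order.TTheory GRing.Theory Num.Theory.
Import numFieldNormedType.Exports.

Local Open Scope classical_set_scope.
Local Open Scope ring_scope.

(* Functions on [0,1] are represented by total functions R -> R of which only
   the values on [0,1] matter, and a polynomial p is identified with the
   function [horner p].  The space of polynomials of degree at most n is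
   [set p : {poly R} | size p <= n.+1]. *)

(* B_n(f).  For n >= 1 the nodes k/n lie in [0,1]. *)
Definition bernstein (R : realType) (n : nat) (f : R -> R) : {poly R} :=
  \sum_(k < n.+1)
    (f (k%:R / n%:R) * 'C(n, k)%:R) *: ('X^k * (1 - 'X) ^+ (n - k)).

(* The library's [beta_fun] only takes natural numbers as arguments. *)
Definition euler_beta (R : realType) (a b : R) : R :=
  \int[lebesgue_measure]_(t in `[0, 1]) (t `^ (a - 1) * (1 - t) `^ (b - 1)).

Definition beta_op (R : realType) (n : nat) (f : R -> R) (x : R) : R :=
  if x == 0 then f 0
  else if x == 1 then f 1
  else (euler_beta (n%:R * x) (n%:R * (1 - x)))^-1 *
    \int[lebesgue_measure]_(t in `[0, 1])
      (t `^ (n%:R * x - 1) * (1 - t) `^ (n%:R * (1 - x) - 1) * f t).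

(* The inverse of the bijection induced by [beta_op n] on the polynomials of
   degree at most n (n >= 1): the polynomial of degree at most n which
   [beta_op n] sends to p.  As usual with [xget], the value 0 is used if there
   is none. *)
Definition beta_op_inv (R : realType) (n : nat) (p : {poly R}) : {poly R} :=
  xget 0 [set q : {poly R} | (size q <= n.+1)%N /\
    forall x : R, 0 <= x <= 1 -> beta_op n (horner q) x = p.[x]].

Definition F_op (R : realType) (n : nat) (f : R -> R) : {poly R} :=
  beta_op_inv n (bernstein n f).

Definition bernstein_eigenval (R : realType) (n k : nat) : R :=
  n`!%:R / ((n - k)`!%:R * n%:R ^+ k).

(* p_k^(n), meaningful for k <= n.  The cases k = 0, 1 are given explicitly
   because both have eigenvalue 1. *)
Definition bernstein_eigenpoly (R : realType) (n k : nat) : {poly R} :=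
  match k with
  | 0 => 1
  | 1 => 'X - (2^-1)%:P
  | _ => xget 0 [set p : {poly R} |
           [/\ p \is monic, size p = k.+1
             & bernstein n (horner p) = bernstein_eigenval R n k *: p]]
  end.

(* p_k^*: the polynomial to which p_k^(n) tends uniformly on [0,1] as n tends
   to infinity.  A polynomial is determined by its values on [0,1], so there is
   at most one. *)
Definition limit_eigenpoly (R : realType) (k : nat) : {poly R} :=
  xget 0 [set p : {poly R} |
    {uniform `[0, 1], (fun n => horner (bernstein_eigenpoly R n k)) @ \oo
                        --> horner p}].

(* Main.v *)
Require Import Defs.
From HB Require Import structures.
From mathcomp Require Import all_boot all_order all_algebra.
From mathcomp Require Import all_classical all_reals all_analysis.
From mathcomp Require Import measurable_realfun ring lra.
Import Order.TTheory GRing.Theory Num.Theory.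
Import numFieldNormedType.Exports.
Set Implicit Arguments.
Unset Strict Implicit.
Unset Printing Implicit Defensive.
Local Open Scope classical_set_scope.
Local Open Scope ring_scope.

(**
Let [m_0 = 1] and [m_(k+1) = X m_k + c X (1 - X) m_k'].  For [c = 1/n] this is
the image of [X^k] under [B_n], and for [c = -1/n] it is the image of [X^k]
under the inverse of the Beta operator, which itself sends [X^k] to
[\prod_(i < k) (n X + i) / (n + i)] by the functional equation of the Beta
integral.  At [c = 0] one gets [m_k = X^k], so both operators tend to the
identity, coefficientwise on polynomials of bounded degree.

Writing [m_k = X^k + c d_k] and [L] for the linear map [X^k |-> d_k], the
eigenpolynomials of [B_n] are those of [L].  As [L] is triangular with diagonal
entries [mu_k], the eigenvector of degree [k] is
[\prod_(j < k) (L - mu_j) / (mu_k - mu_j)] applied to [X^k].  At [c = 0] the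
entries [mu_k] are [- k (k - 1) / 2], distinct for different [k >= 1], so for
[k >= 2] the formula is continuous in [c] there: [p_k^(n)] converges
coefficientwise, and applying an operator that tends to the identity, or
multiplying by an eigenvalue that tends to 1, does not change the limit.
*)

(** * Moments and the Bernstein operator *)

(** Identities between linear operators then need checking on monomials only, where induction on the
    exponent is available. *)
Lemma poly_linear_ind (R : nzRingType) (P : {poly R} -> Prop) :
  (forall a p q, P p -> P q -> P (a *: p + q)) -> (forall k, P 'X^k) ->
  forall p, P p.
Proof.
move=> Plin PX p; have P0 : P 0.
  by rewrite -[0](addNr 1) -scaleN1r; exact: (Plin _ _ _ (PX 0%N) (PX 0%N)).
rewrite -[p]coefK poly_def; apply: (big_ind P) => // [q r Pq Pr|i _].
  by rewrite -[q]scale1r; apply: Plin.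
by rewrite -[X in P X]addr0; apply: Plin.
Qed.

Definition lin_ext (R : comNzRingType) (m : nat -> {poly R}) (p : {poly R}) :=
  \sum_(k < size p) p`_k *: m k.

(** The range of the sum in [lin_ext] depends on [p]; linearity and limits need a common range. *)
Lemma lin_ext_wide (R : comNzRingType) (m : nat -> {poly R}) (p : {poly R}) N :
  (size p <= N)%N -> lin_ext m p = \sum_(k < N) p`_k *: m k.
Proof.
move=> pN; rewrite /lin_ext.
rewrite (big_ord_widen_cond _ (fun=> true) (fun k => p`_k *: m k) pN).
rewrite big_mkcond; apply: eq_bigr => k _ /=.
by case: ltnP => // pk; rewrite nth_default ?scale0r.
Qed.

Lemma lin_ext_is_linear (R : comNzRingType) (m : nat -> {poly R}) :
  linear (lin_ext m).
Proof.
move=> a p q; pose N := maxn (size (a *: p + q)) (maxn (size p) (size q)).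
rewrite !(@lin_ext_wide _ _ _ N) ?leq_max ?leqnn ?orbT//.
rewrite scaler_sumr -big_split /=; apply: eq_bigr => k _.
by rewrite coefD coefZ scalerDl scalerA.
Qed.

HB.instance Definition _ (R : comNzRingType) (m : nat -> {poly R}) :=
  GRing.isLinear.Build R {poly R} {poly R} _ (lin_ext m) (lin_ext_is_linear m).

Lemma lin_extZ (R : comNzRingType) (m : nat -> {poly R}) a p :
  lin_ext m (a *: p) = a *: lin_ext m p.
Proof. exact: linearZ. Qed.

Lemma lin_extXn (R : comNzRingType) (m : nat -> {poly R}) k :
  lin_ext m 'X^k = m k.
Proof.
rewrite /lin_ext size_polyXn big_ord_recr big1 /= => [|i _].
  by rewrite coefXn eqxx scale1r add0r.
by rewrite coefXn ltn_eqF// scale0r.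
Qed.

Fixpoint moment (R : comNzRingType) (c : R) (k : nat) : {poly R} :=
  if k is k'.+1 then
    'X * moment c k' + c *: ('X * (1 - 'X) * (moment c k')^`())
  else 1.

(** The quotient of [moment c k - 'X^k] by [c], given by a recursion that still makes sense at
    [c = 0]. *)
Fixpoint moment_quot (R : comNzRingType) (c : R) (k : nat) : {poly R} :=
  if k is k'.+1 then
    'X * moment_quot c k' + 'X * (1 - 'X) * (moment c k')^`()
  else 0.

Lemma momentE (R : comNzRingType) (c : R) k :
  moment c k = 'X^k + c *: moment_quot c k.
Proof.
elim: k => [|k IH] /=; first by rewrite scaler0 addr0.
by rewrite {1}IH exprS mulrDr scalerDr -scalerAr addrA.
Qed.

Lemma coef_X1XM_deriv (R : comNzRingType) (p : {poly R}) j :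
  ('X * (1 - 'X) * p^`())`_j = p`_j *+ j - p`_j.-1 *+ j.-1.
Proof.
rewrite -mulrA coefXM; case: j => [|j] /=; first by rewrite !mulr0n subr0.
rewrite mulrBl mul1r coefB coefXM !coef_deriv.
by case: j => [|j] //=; rewrite mulr0n.
Qed.

(** The two bounds go together because the recursion of [moment_quot] differentiates [moment].
    Passing from [p] to [X (1 - X) p'] raises the degree by at most one. *)
Lemma size_moment_quot (R : comNzRingType) (c : R) k :
  (size (moment_quot c k) <= k.+1)%N /\ (size (moment c k) <= k.+1)%N.
Proof.
elim: k => [|k [IH1 IH2]]; first by rewrite size_poly0 size_poly1.
have S1 : (size ('X * moment_quot c k + 'X * (1 - 'X) * (moment c k)^`())%R <=
    k.+2)%N.
  apply/leq_sizeP => j kj; rewrite coefD coef_X1XM_deriv coefXM.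
  by rewrite !nth_default ?mul0rn ?subr0 ?addr0 ?if_same //;
    apply: leq_trans (_ : k.+1 <= _)%N => //; case: j kj => // j /ltnW.
split; first exact: S1.
rewrite momentE; apply: leq_trans (size_polyD _ _) _.
rewrite size_polyXn geq_max leqnn /=.
exact: leq_trans (size_scale_leq _ _) S1.
Qed.

Lemma coef_moment_lead (R : comNzRingType) (c : R) k :
  (moment c k)`_k = \prod_(i < k) (1 - c * i%:R).
Proof.
elim: k => [|k IH]; first by rewrite big_ord0 coefC.
rewrite big_ord_recr -IH /= coefD coefXM coefZ coef_X1XM_deriv /=.
rewrite [(moment c k)`_k.+1]nth_default ?(size_moment_quot c k).2//.
by rewrite mul0rn sub0r -mulr_natr; ring.
Qed.

Lemma lin_ext_momentXM (R : comNzRingType) (c : R) (p : {poly R}) :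
  lin_ext (moment c) ('X * p) = 'X * lin_ext (moment c) p +
    c *: ('X * (1 - 'X) * (lin_ext (moment c) p)^`()).
Proof.
elim/poly_linear_ind: p => [a p q Hp Hq|k].
  rewrite mulrDr -scalerAr !lin_ext_is_linear derivD derivZ Hp Hq -!mul_polyC.
  by ring.
by rewrite -exprS !lin_extXn.
Qed.

Lemma lin_ext_momentE (R : comNzRingType) (c : R) (p : {poly R}) :
  lin_ext (moment c) p = p + c *: lin_ext (moment_quot c) p.
Proof.
elim/poly_linear_ind: p => [a p q Hp Hq|k].
  by rewrite !lin_ext_is_linear Hp Hq -!mul_polyC; ring.
by rewrite !lin_extXn momentE.
Qed.

(** * The Bernstein operator on polynomials *)

Lemma bernstein_linear (R : realType) n (a : R) (p q : {poly R}) :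
  bernstein n (horner (a *: p + q)) =
  a *: bernstein n (horner p) + bernstein n (horner q).
Proof.
rewrite /bernstein scaler_sumr -big_split /=; apply: eq_bigr => k _.
by rewrite hornerD hornerZ scalerA mulrDl scalerDl mulrA.
Qed.

Lemma bernstein1 (R : realType) n : bernstein n (horner (1 : {poly R})) = 1.
Proof.
rewrite /bernstein -[RHS](expr1n _ n) -[X in X ^+ n](subrK 'X) exprDn.
by apply: eq_bigr => k _; rewrite hornerC mul1r scaler_nat mulrC.
Qed.

Lemma X1XM_deriv_bernstein_basis (R : comNzRingType) n k : (k <= n)%N ->
  'X * (1 - 'X) * ('X^k * (1 - 'X) ^+ (n - k))^`() =
  (k%:R - n%:R * 'X) * ('X^k * (1 - 'X) ^+ (n - k)) :> {poly R}.
Proof.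
move=> kn; rewrite -{2}(subnK kn); move: (n - k)%N => m.
rewrite derivM derivXn deriv_exp derivB derivX derivC sub0r natrD.
rewrite -(mulr_natr (_ ^+ k.-1)) -(mulr_natr (_ * _ ^+ m.-1)).
(* The factor [j] makes the truncated predecessor harmless: at [j = 0] both sides vanish. *)
have XX j : 'X * ('X^(j.-1) * j%:R) = 'X^j * j%:R :> {poly R}.
  by case: j => [|j]; rewrite ?mulr0 //= exprS mulrA.
have YY j : (1 - 'X) * ((1 - 'X) ^+ j.-1 * j%:R) =
    (1 - 'X) ^+ j * j%:R :> {poly R}.
  by case: j => [|j]; rewrite ?mulr0 //= exprS mulrA.
transitivity ((1 - 'X) * (1 - 'X) ^+ m * ('X * ('X^(k.-1) * k%:R)) -
   'X * 'X^k * ((1 - 'X) * ((1 - 'X) ^+ m.-1 * m%:R)) : {poly R}).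
  by ring.
by rewrite XX YY; ring.
Qed.

(** At the node [k / n] the factor ['X] has the value [k / n], and by the differential equation of
    the basis [(k / n) b = X b + (1 / n) X (1 - X) b']. *)
Lemma bernsteinXM (R : realType) n (p : {poly R}) : (0 < n)%N ->
  bernstein n (horner ('X * p)) = 'X * bernstein n (horner p) +
    n%:R^-1 *: ('X * (1 - 'X) * (bernstein n (horner p))^`()).
Proof.
move=> n0; rewrite /bernstein linear_sum !mulr_sumr scaler_sumr -big_split /=.
apply: eq_bigr => k _; rewrite derivZ hornerM hornerX.
rewrite -!scalerAr X1XM_deriv_bernstein_basis ?leq_ord// -!mul_polyC !polyCM.
have un : n%:R^-1%:P * n%:R = 1 :> {poly R}.
  by rewrite -polyC_natr -polyCM mulVf// pnatr_eq0 -lt0n.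
rewrite polyC_natr; set b := 'X^k * _; set v := (_.[_])%:P.
by ring: un.
Qed.

Lemma bernsteinE (R : realType) n (p : {poly R}) : (0 < n)%N ->
  bernstein n (horner p) = lin_ext (moment n%:R^-1) p.
Proof.
move=> n0; elim/poly_linear_ind: p => [a p q Hp Hq|k].
  by rewrite bernstein_linear Hp Hq lin_ext_is_linear.
rewrite lin_extXn; elim: k => [|k IH]; first exact: bernstein1.
by rewrite exprS bernsteinXM// IH.
Qed.

Lemma bernstein_eigenvalE (R : realType) n k : (k <= n)%N -> (0 < n)%N ->
  bernstein_eigenval R n k = \prod_(i < k) (1 - n%:R^-1 * i%:R).
Proof.
move=> kn n0; have n0R : n%:R != 0 :> R by rewrite pnatr_eq0 -lt0n.
elim: k kn => [|k IH] kn.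
  by rewrite big_ord0 /bernstein_eigenval subn0 expr0 mulr1 divff// pnatr_eq0 -lt0n fact_gt0.
rewrite big_ord_recr -IH 1?ltnW//= /bernstein_eigenval.
have -> : (n - k)`! = ((n - k) * (n - k.+1)`!)%N.
  by rewrite -[in LHS](subnSK kn) factS subnSK.
have f0 : ((n - k.+1)`!)%:R != 0 :> R by rewrite pnatr_eq0 -lt0n fact_gt0.
rewrite natrM natrB 1?ltnW// exprS. field.
rewrite n0R f0 subr_eq0 eqr_nat neq_ltn kn orbT expf_neq0//.
Qed.

(** * The inverse of the Beta operator on polynomials *)

(** In terms of rising factorials [(y)_k], this is [(n X)_k / (n)_k]. *)
Fixpoint rising (R : fieldType) (n : R) (k : nat) : {poly R} :=
  if k is k'.+1 then
    (n + k'%:R)^-1 *: ((n *: 'X + k'%:R%:P) * rising n k')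
  else 1.

Lemma X1XM_derivXn (R : comNzRingType) k :
  'X * (1 - 'X) * ('X^k)^`() = (1 - 'X) * ('X^k * k%:R) :> {poly R}.
Proof.
by rewrite derivXn -mulr_natr; case: k => [|k]; rewrite ?mulr0//= exprS; ring.
Qed.

(** The argument on the left is one step of the moment recursion at [c = - 1 / n]. For [q = X^k] it
    is [((n + k) X^(k+1) - k X^k) / n], and the images [r_k] satisfy
    [(n + k) r_(k+1) = (n X + k) r_k], so that just [X r_k] is left. *)
Lemma lin_ext_rising_step (R : numFieldType) (n : R) (q : {poly R}) : 0 < n ->
  lin_ext (rising n) ('X * q - n^-1 *: ('X * (1 - 'X) * q^`())) =
  'X * lin_ext (rising n) q.
Proof.
move=> n0; elim/poly_linear_ind: q => [a p q Hp Hq|k].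
  rewrite lin_ext_is_linear [in RHS]mulrDr -[in RHS]scalerAr -Hp -Hq.
  rewrite -lin_ext_is_linear.
  congr lin_ext; rewrite derivD derivZ -!mul_polyC; ring.
have nk : n + k%:R != 0 by rewrite gt_eqF// ltr_wpDr.
have -> : 'X * 'X^k - n^-1 *: ('X * (1 - 'X) * ('X^k)^`()) =
    (n^-1 * (n + k%:R)) *: 'X^(k.+1) + (- (n^-1 * k%:R)) *: 'X^k :> {poly R}.
  rewrite X1XM_derivXn exprS.
  have nn : n^-1%:P * n%:P = 1 :> {poly R} by rewrite -polyCM mulVf// gt_eqF.
  rewrite -!mul_polyC !(polyCM, polyCD, polyCN) polyC_natr.
  by ring: nn.
rewrite lin_ext_is_linear lin_extZ.
rewrite !lin_extXn /= scalerA -mulrA divff// mulr1 -!mul_polyC.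
have nn : n^-1%:P * n%:P = 1 :> {poly R} by rewrite -polyCM mulVf// gt_eqF.
by rewrite polyCN polyCM; ring: nn.
Qed.

Lemma lin_ext_risingK (R : numFieldType) (n : R) : 0 < n ->
  cancel (lin_ext (moment (- n^-1))) (lin_ext (rising n)).
Proof.
move=> n0 p; elim/poly_linear_ind: p => [a p q Hp Hq|k].
  by rewrite !lin_ext_is_linear Hp Hq.
rewrite lin_extXn; elim: k => [|k IH].
  exact: (lin_extXn (rising n) 0).
by rewrite /= scaleNr lin_ext_rising_step// IH exprS.
Qed.

(** This composite makes [lin_ext (rising n)] injective, hence preimages under the Beta operator
    unique. *)
Lemma lin_ext_momentK (R : numFieldType) (n : R) : 0 < n ->
  cancel (lin_ext (rising n)) (lin_ext (moment (- n^-1))).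
Proof.
move=> n0 p; elim/poly_linear_ind: p => [a p q Hp Hq|k].
  by rewrite !lin_ext_is_linear Hp Hq.
rewrite lin_extXn; elim: k => [|k IH].
  exact: (lin_extXn (moment (- n^-1)) 0).
have nk : n + k%:R != 0 by rewrite gt_eqF// ltr_wpDr.
rewrite /= mulrDl -scalerAl mul_polyC lin_extZ lin_ext_is_linear lin_extZ.
rewrite lin_ext_momentXM IH X1XM_derivXn.
apply: (scalerI nk); rewrite scalerA divff// scale1r exprS.
have nn : n^-1%:P * n%:P = 1 :> {poly R} by rewrite -polyCM mulVf// gt_eqF.
rewrite -!mul_polyC !(polyCM, polyCD, polyCN) !polyC_natr.
by ring: nn.
Qed.

Lemma size_lin_ext (R : comNzRingType) (m : nat -> {poly R}) (p : {poly R}) N :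
  (forall k, size (m k) <= k.+1)%N -> (size p <= N)%N ->
  (size (lin_ext m p) <= N)%N.
Proof.
move=> sm pN; rewrite (lin_ext_wide _ pN); apply/leq_sizeP => j Nj.
rewrite coef_sum big1// => k _; rewrite coefZ [(m k)`_j]nth_default ?mulr0//.
by apply: leq_trans (sm k) _; apply: leq_trans (ltn_ord k) Nj.
Qed.

(** Triangularity: the images of lower monomials do not reach degree [N]. *)
Lemma coef_lin_ext_top (R : comNzRingType) (m : nat -> {poly R})
    (p : {poly R}) N :
  (forall k, size (m k) <= k.+1)%N -> (size p <= N.+1)%N ->
  (lin_ext m p)`_N = p`_N * (m N)`_N.
Proof.
move=> sm pN; rewrite (lin_ext_wide _ pN) coef_sum big_ord_recr.
rewrite big1 /= => [|k _]; first by rewrite add0r coefZ.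
by rewrite coefZ [(m k)`_N]nth_default ?mulr0//; apply: leq_trans (sm k) _.
Qed.

(** * Eigenvectors *)

(** The diagonal entry [mu_k] of the triangular map [L]. *)
Definition quot_lead (R : comNzRingType) (c : R) k : R := (moment_quot c k)`_k.

(** The product of the factors [L - mu_j] over [j < m], the one of largest index being applied
    first. *)
Fixpoint peel (R : comNzRingType) (c : R) (m : nat) (p : {poly R}) : {poly R} :=
  if m is m'.+1 then
    peel c m' (lin_ext (moment_quot c) p - quot_lead c m' *: p)
  else p.

Definition eigenvec (R : fieldType) (c : R) (k : nat) : {poly R} :=
  (\prod_(j < k) (quot_lead c k - quot_lead c j))^-1 *: peel c k 'X^k.

Lemma peel_is_linear (R : comNzRingType) (c : R) m : linear (peel c m).
Proof.
elim: m => [|m IH] //= a p q; rewrite lin_ext_is_linear -IH; congr peel.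
by rewrite -!mul_polyC; ring.
Qed.

Lemma size_peel_step (R : comNzRingType) (c a : R) N (p : {poly R}) :
  (size p <= N)%N -> (size (lin_ext (moment_quot c) p - a *: p)%R <= N)%N.
Proof.
move=> pN; apply: leq_trans (size_polyD _ _) _; rewrite size_polyN geq_max.
rewrite (leq_trans (size_scale_leq _ _) pN) andbT.
by apply: size_lin_ext => // k; exact: (size_moment_quot c k).1.
Qed.

Lemma coef_peel (R : comNzRingType) (c : R) m k (p : {poly R}) :
  (size p <= k.+1)%N -> (size (peel c m p) <= k.+1)%N /\
  (peel c m p)`_k = (\prod_(j < m) (quot_lead c k - quot_lead c j)) * p`_k.
Proof.
elim: m p => [|m IH] p pk /=; first by rewrite big_ord0 mul1r.
have [-> ->] := IH _ (size_peel_step c (quot_lead c m) pk); split=> //.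
rewrite coefB coefZ coef_lin_ext_top//; last by move=> j; exact: (size_moment_quot c j).1.
by rewrite big_ord_recr /= /quot_lead; ring.
Qed.

(** Each factor annihilates the highest coefficient left and so lowers the degree: Cayley-Hamilton
    for a triangular map. *)
Lemma peel_eq0 (R : comNzRingType) (c : R) m (p : {poly R}) :
  (size p <= m)%N -> peel c m p = 0.
Proof.
elim: m p => [|m IH] p pm /=; first by apply/eqP; rewrite -size_poly_leq0.
apply/IH/leq_sizeP => j; rewrite leq_eqVlt => /predU1P[<-|mj].
  rewrite coefB coefZ coef_lin_ext_top//; last by move=> i; exact: (size_moment_quot c i).1.
  by rewrite mulrC subrr.
by rewrite nth_default//; apply: leq_trans mj; exact: size_peel_step.
Qed.

(* Hence the factor of index [k] may be applied last, so that [peel c k.+1 'X^k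
   = 0] says that [peel c k 'X^k] is an eigenvector. *)
Lemma peel_lin_ext (R : comNzRingType) (c : R) m (p : {poly R}) :
  peel c m (lin_ext (moment_quot c) p) = lin_ext (moment_quot c) (peel c m p).
Proof.
elim: m p => [|m IH] p //=; rewrite -IH; congr peel.
by rewrite addrC -scaleNr -lin_ext_is_linear addrC scaleNr.
Qed.

Lemma eigenvecP (R : fieldType) (c : R) k :
  (forall j, (j < k)%N -> quot_lead c j != quot_lead c k) ->
  [/\ eigenvec c k \is monic, size (eigenvec c k) = k.+1 &
    lin_ext (moment_quot c) (eigenvec c k) = quot_lead c k *: eigenvec c k].
Proof.
move=> ne; set P := \prod_(j < k) (quot_lead c k - quot_lead c j).
have P0 : P != 0.
  by apply/prodf_neq0 => j _; rewrite subr_eq0 eq_sym ne.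
have sX : (size ('X^k : {poly R}) <= k.+1)%N by rewrite size_polyXn.
have [sp cp] := coef_peel c k sX.
have c1 : (eigenvec c k)`_k = 1.
  by rewrite coefZ cp coefXn eqxx mulr1 mulVf.
have sv : size (eigenvec c k) = k.+1.
  apply/eqP; rewrite eqn_leq (leq_trans (size_scale_leq _ _) sp)/=.
  by rewrite ltnNge; apply/negP => /leq_sizeP/(_ k (leqnn k))/eqP; rewrite c1 oner_eq0.
split=> //; first by rewrite monicE lead_coefE sv c1.
rewrite /eigenvec lin_extZ -peel_lin_ext scalerA mulrC -scalerA.
congr (_ *: _); apply/eqP; rewrite -subr_eq0 -scaleNr addrC -peel_is_linear.
by rewrite addrC scaleNr; apply/eqP; exact: (@peel_eq0 _ c k.+1 'X^k sX).
Qed.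

(** A nonzero difference would have some degree [d < k], and comparing its coefficients of degree
    [d] would give [mu_d = mu_k]. *)
Lemma eigenvec_unique (R : fieldType) (c : R) k (p q : {poly R}) :
  (forall j, (j < k)%N -> quot_lead c j != quot_lead c k) ->
  p \is monic -> size p = k.+1 ->
  lin_ext (moment_quot c) p = quot_lead c k *: p ->
  q \is monic -> size q = k.+1 ->
  lin_ext (moment_quot c) q = quot_lead c k *: q -> p = q.
Proof.
move=> ne pm sp Lp qm sq Lq; apply/eqP; rewrite -subr_eq0.
set r := p - q; have Lr : lin_ext (moment_quot c) r = quot_lead c k *: r.
  by rewrite /r addrC -scaleN1r lin_ext_is_linear Lp Lq -!mul_polyC; ring.
have sr : (size r <= k)%N.
  apply/leq_sizeP => j; rewrite leq_eqVlt coefB => /predU1P[<-|kj].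
    move: pm qm; rewrite !monicE !lead_coefE sp sq /= => /eqP-> /eqP->.
    by rewrite subrr.
  by rewrite !nth_default ?sp ?sq// subrr.
apply/negPn/negP => r0; have := r0; rewrite -size_poly_gt0 => s0.
have dk : ((size r).-1 < k)%N by rewrite prednK.
have /(congr1 (fun p : {poly R} => p`_(size r).-1)) := Lr.
rewrite coefZ coef_lin_ext_top ?prednK//; last by move=> i; exact: (size_moment_quot c i).1.
have rd : r`_(size r).-1 != 0 by rewrite -lead_coefE lead_coef_eq0.
by rewrite mulrC => /(mulIf rd)/eqP; apply/negP/ne.
Qed.

(** * The Beta integral *)

Definition beta_kernel (R : realType) (a b t : R) : R :=
  t `^ (a - 1) * (1 - t) `^ (b - 1).

Lemma is_derive_beta_kernel (R : realType) (a b t : R) : 0 < t -> t < 1 ->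
  is_derive t 1 (fun u : R => u `^ a * (1 - u) `^ b)
    (a * t `^ (a - 1) * (1 - t) `^ b - b * t `^ a * (1 - t) `^ (b - 1)).
Proof.
move=> t0 t1.
have d1 := @is_derive1_powR R a t t0.
have t1' : 0 < 1 - t by rewrite subr_gt0.
have d2 := @is_derive1_powR R b (1 - t) t1'.
have d3 : is_derive t 1 (fun u : R => 1 - u) (-1).
  by rewrite -[-1]sub0r; apply: is_deriveB.
have d4 := @is_derive1_comp R (@powR R ^~ b) (fun u => 1 - u) t _ _ d2 d3.
apply: is_derive_eq (is_deriveM d1 d4) _.
by rewrite /GRing.scale /=; ring.
Qed.

Lemma powR_split (R : realType) (a t : R) : 0 < t -> t `^ a = t * t `^ (a - 1).
Proof.
move=> t0; rewrite -{2}(powRr1 (ltW t0)) -powRD ?(gt_eqF t0) ?implybT//.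
by rewrite addrC subrK.
Qed.

Lemma beta_kernelDl (R : realType) (a b t : R) : 0 < t ->
  beta_kernel (a + 1) b t = t * beta_kernel a b t.
Proof. by move=> t0; rewrite /beta_kernel addrK (powR_split _ t0) mulrA. Qed.

Lemma beta_kernelDr (R : realType) (a b t : R) : t < 1 ->
  beta_kernel a (b + 1) t = (1 - t) * beta_kernel a b t.
Proof.
by move=> t1; rewrite /beta_kernel addrK (@powR_split _ b) ?subr_gt0// mulrCA.
Qed.

Lemma beta_kernel_ge0 (R : realType) (a b t : R) : 0 <= beta_kernel a b t.
Proof. by rewrite mulr_ge0// powR_ge0. Qed.

Lemma measurable_beta_kernel (R : realType) (a b : R) (D : set R) :
  measurable_fun D (beta_kernel a b).
Proof.
apply: (measurable_funS measurableT) => //; apply: measurable_funM.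
  exact: measurable_powR.
apply: (measurableT_comp (measurable_powR (b - 1))).
by apply: measurable_funB.
Qed.

Lemma derivable_beta_kernel (R : realType) (a b t : R) : 0 < t -> t < 1 ->
  derivable (beta_kernel a b) t 1.
Proof.
by move=> t0 t1; have [] := is_derive_beta_kernel (a - 1) (b - 1) t0 t1.
Qed.

(** Away from the endpoints the kernel is continuous whatever the exponents are. *)
Definition beta_trunc (R : realType) (e a b : R) : R :=
  \int[lebesgue_measure]_(t in `[e, 1 - e]) beta_kernel a b t.

Lemma beta_kernel_continuous (R : realType) (a b e : R) : 0 < e ->
  {within `[e, 1 - e], continuous (beta_kernel a b)}.
Proof.
move=> e0; apply: derivable_within_continuous => t; rewrite in_itv/= => /andP[et te].
by apply: derivable_beta_kernel; lra.
Qed.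

Lemma beta_kernel_trunc_integrable (R : realType) (a b e : R) : 0 < e ->
  lebesgue_measure.-integrable `[e, 1 - e] (EFin \o beta_kernel a b).
Proof.
move=> e0; apply: continuous_compact_integrable; first exact: segment_compact.
exact: beta_kernel_continuous.
Qed.

(** With [K] the kernel, the derivative of [t^a (1 - t)^b] is [a K(a, b) - (a + b) K(a + 1, b)]. *)
Lemma beta_trunc_FTC (R : realType) (a b e : R) : 0 < e -> e < 2^-1 ->
  a * beta_trunc e a b - (a + b) * beta_trunc e (a + 1) b =
  (1 - e) `^ a * e `^ b - e `^ a * (1 - e) `^ b.
Proof.
move=> e0 e2; have ee : e < 1 - e by lra.
have int a' b' := @beta_kernel_trunc_integrable R a' b' e e0.
rewrite /beta_trunc -!RintegralZl// -RintegralB//; first last.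
- by apply: eq_integrable (integrableZl _ _ (int _ _)).
- by apply: eq_integrable (integrableZl _ _ (int _ _)).
pose f t := a * beta_kernel a b t - (a + b) * beta_kernel (a + 1) b t.
pose F (u : R) := u `^ a * (1 - u) `^ b.
rewrite /Rintegral (@continuous_FTC2 _ f F)//.
- by rewrite /= /F subKr.
- apply: derivable_within_continuous => t; rewrite in_itv/= => /andP[et te].
  by apply: derivableB; apply: derivableM => //; apply: derivable_beta_kernel; lra.
- have dF t : 0 < t -> t < 1 -> derivable F t 1.
    by move=> t0 t1; have [] := is_derive_beta_kernel a b t0 t1.
  have cF t : 0 < t -> t < 1 -> {for t, continuous F}.
    by move=> t0 t1; apply/differentiable_continuous/derivable1_diffP/dF.
  split.
  + by move=> t; rewrite in_itv/= => /andP[et te]; apply: dF; lra.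
  + by apply: cvg_at_right_filter; apply: cF; lra.
  + by apply: cvg_at_left_filter; apply: cF; lra.
- move=> t; rewrite in_itv/= => /andP[et te].
  have t0 : 0 < t by lra.
  have t1 : t < 1 by lra.
  rewrite derive1E (derive_val (is_derive := is_derive_beta_kernel a b t0 t1)).
  rewrite /f beta_kernelDl// /beta_kernel (powR_split a t0).
  rewrite (@powR_split _ b (1 - t)) ?subr_gt0//.
  by ring.
Qed.

Lemma beta_trunc_split (R : realType) (a b e : R) : 0 < e -> e < 2^-1 ->
  beta_trunc e a b = beta_trunc e (a + 1) b + beta_trunc e a (b + 1).
Proof.
move=> e0 e2.
have int a' b' := @beta_kernel_trunc_integrable R a' b' e e0.
rewrite /beta_trunc -RintegralD//; apply: eq_Rintegral => t.
rewrite inE/= in_itv/= => /andP[et te].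
by rewrite beta_kernelDl ?beta_kernelDr; [ring|lra|lra].
Qed.

(** * Uniform bounds and convergence of the truncated integrals *)

Lemma powR_le1 (R : realType) (x a : R) :
  0 <= x -> x <= 1 -> 0 <= a -> x `^ a <= 1.
Proof.
move=> x0 x1 a0; have := @ge0_ler_powR R a a0 x 1; rewrite powR1.
by apply; rewrite ?nnegrE.
Qed.

Lemma beta_trunc_le1 (R : realType) (a b e : R) : 0 <= a -> 0 <= b ->
  0 < e -> e < 2^-1 -> beta_trunc e (a + 1) (b + 1) <= 1.
Proof.
move=> a0 b0 e0 e2.
apply: (@le_trans _ _ (\int[lebesgue_measure]_(t in `[e, 1 - e]) 1)).
  apply: le_Rintegral => //; first exact: beta_kernel_trunc_integrable.
    apply: continuous_compact_integrable; first exact: segment_compact.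
    by move=> t; exact: cvg_cst.
  move=> t /=; rewrite in_itv/= => /andP[et te].
  by rewrite /beta_kernel !addrK mulr_ile1 ?powR_ge0 ?powR_le1//; lra.
rewrite Rintegral_cst//= lebesgue_measure_itv/= lte_fin mul1r.
have ee : e < 1 - e by lra.
by rewrite ee -EFinB/=; lra.
Qed.

(* By the integration by parts of [beta_trunc_FTC], raising an exponent by 1
   changes the truncated integral by a bounded factor and a bounded error, and
   with both exponents raised the kernel is at most 1.  The bound does not
   depend on [e], so the improper integral converges. *)
Lemma beta_trunc_le (R : realType) (a b e : R) : 0 < a -> 0 < b ->
  0 < e -> e < 2^-1 ->
  beta_trunc e a b <= ((a + b) * ((a + 1 + b + 1) / b) + 1) / a.
Proof.
move=> a0 b0 e0 e2.
have p1 (x c : R) : 0 < x -> x < 1 -> 0 < c -> 0 <= x `^ c <= 1.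
  by move=> x0 x1 c0; rewrite powR_ge0 powR_le1 ?ltW.
have e1 : e < 1 by lra.
have e1' : 0 < 1 - e by lra.
have e1'' : 1 - e < 1 by lra.
have a10 : 0 < a + 1 by lra.
(* Both boundary products lie in [[0, 1]]. *)
have dl (c : R) : 0 < c ->
    - 1 <= c * beta_trunc e c b - (c + b) * beta_trunc e (c + 1) b <= 1.
  move=> c0; rewrite beta_trunc_FTC//.
  have /andP[u0 u1] := p1 _ _ e0 e1 c0; have /andP[v0 v1] := p1 _ _ e0 e1 b0.
  have /andP[w0 w1] := p1 _ _ e1' e1'' c0.
  have /andP[z0 z1] := p1 _ _ e1' e1'' b0.
  have := mulr_ile1 w0 v0 w1 v1; have := mulr_ile1 u0 z0 u1 z1.
  by have := mulr_ge0 w0 v0; have := mulr_ge0 u0 z0; lra.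
(* Splitting the integral eliminates the one with parameter [a + 2]; [b] times the wanted integral
   is then compared with the integral in which both parameters are raised. *)
have J1 : beta_trunc e (a + 1) b <= (a + 1 + b + 1) / b.
  rewrite ler_pdivlMr//.
  have := beta_trunc_le1 (ltW a0) (ltW b0) e0 e2.
  have := dl _ a10; have := beta_trunc_split (a + 1) b e0 e2.
  move: (beta_trunc e (a + 1) b) (beta_trunc e (a + 1 + 1) b).
  move: (beta_trunc e (a + 1) (b + 1)).
  move=> z x y -> /andP[D1 D2] z1.
  have : (a + 1 + b) * z <= (a + 1 + b) * 1 by rewrite ler_wpM2l//; lra.
  by lra.
rewrite ler_pdivlMr//.
have /andP[D1 D2] := dl _ a0.
have : (a + b) * beta_trunc e (a + 1) b <= (a + b) * ((a + 1 + b + 1) / b).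
  by rewrite ler_wpM2l//; lra.
by lra.
Qed.

(* The shift by 3 keeps the cutoff below 1/2. *)
Definition cut (R : realType) (i : nat) : R := i.+3%:R^-1.

Lemma cut_gt0 (R : realType) i : 0 < cut R i.
Proof. by rewrite invr_gt0. Qed.

Lemma cut_lt (R : realType) i : cut R i < 2^-1.
Proof. by rewrite ltf_pV2 ?posrE// ltr_nat. Qed.

Lemma bigcup_cut (R : realType) :
  \bigcup_i `[cut R i, 1 - cut R i]%classic = `]0, 1[%classic.
Proof.
apply/seteqP; split => [t [i _] | t] /=.
  rewrite !in_itv/= => /andP[ti it]; have := cut_gt0 R i.
  by move=> c0; apply/andP; split; lra.
rewrite in_itv/= => /andP[t0 t1].
pose m := Num.min t (1 - t); have m0 : 0 < m by rewrite lt_min t0/=; lra.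
(* As [m] is the distance from [t] to the nearer endpoint, any [i] with [1 / (i + 3) <= m] will
   do. *)
exists (Num.bound m^-1) => //=.
have cm : cut R (Num.bound m^-1) <= m.
  rewrite /cut -[leRHS]invrK lef_pV2 ?posrE ?invr_gt0//.
  apply: ltW; apply: lt_le_trans (archi_boundP _) _; first by rewrite invr_ge0 ltW.
  by rewrite ler_nat -addn3 leq_addr.
move: cm; rewrite le_min in_itv/= => /andP[-> ?] /=; lra.
Qed.

(** Monotone convergence, stated in the extended reals because the limit is not yet known to be
    finite. *)
Lemma cvg_beta_trunc_ereal (R : realType) (a b : R) :
  (\int[lebesgue_measure]_(t in `[cut R i, (1 - cut R i)%R])
    (beta_kernel a b t)%:E)%E
     @[i --> \oo] -->
  (\int[lebesgue_measure]_(t in `]0%R, 1%R[) (beta_kernel a b t)%:E)%E.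
Proof.
rewrite -bigcup_cut; apply: ge0_nondecreasing_set_cvg_integral => //.
- move=> i j ij; rewrite subsetEset => t /=; rewrite !in_itv/= => /andP[ti it].
  have : cut R j <= cut R i by rewrite lef_pV2 ?posrE// ler_nat !ltnS.
  by move=> ?; apply/andP; split; lra.
- by move=> i; apply/measurable_EFinP; exact: measurable_beta_kernel.
- by move=> i t _; rewrite lee_fin beta_kernel_ge0.
Qed.

Lemma beta_kernel_integrable (R : realType) (a b : R) : 0 < a -> 0 < b ->
  lebesgue_measure.-integrable `]0, 1[ (EFin \o beta_kernel a b).
Proof.
move=> a0 b0; apply/integrableP; split.
  by apply/measurable_EFinP; exact: measurable_beta_kernel.
under eq_integral do rewrite /= ger0_norm ?beta_kernel_ge0//.
set K := ((a + b) * ((a + 1 + b + 1) / b) + 1) / a.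
apply: (@le_lt_trans _ _ K%:E); last exact: ltry.
rewrite -(cvg_lim _ (@cvg_beta_trunc_ereal R a b))//.
apply: lime_le; first by apply/cvg_ex; eexists; exact: cvg_beta_trunc_ereal.
apply: nearW => i.
have int := beta_kernel_trunc_integrable a b (cut_gt0 R i).
rewrite -[X in (X <= _)%E]fineK; last exact: integrable_fin_num.
by rewrite lee_fin; apply: beta_trunc_le => //; [exact: cut_gt0|exact: cut_lt].
Qed.

(** The endpoints have measure zero; on the open interval both bases are positive. *)
Lemma euler_beta_oo (R : realType) (a b : R) : 0 < a -> 0 < b ->
  euler_beta a b = \int[lebesgue_measure]_(t in `]0, 1[) beta_kernel a b t.
Proof.
move=> a0 b0; rewrite /Rintegral -(@integral_itv_bndoo _ _ _ _ true false)//.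
by apply/measurable_EFinP; exact: measurable_beta_kernel.
Qed.

Lemma cvg_beta_trunc (R : realType) (a b : R) : 0 < a -> 0 < b ->
  beta_trunc (cut R i) a b @[i --> \oo] --> euler_beta a b.
Proof.
move=> a0 b0; rewrite euler_beta_oo//; apply: fine_cvg; rewrite fineK.
  exact: cvg_beta_trunc_ereal.
by apply: integrable_fin_num => //; exact: beta_kernel_integrable.
Qed.

Lemma cvg_cut (R : realType) : cut R i @[i --> \oo] --> (0 : R).
Proof.
apply: (squeeze_cvgr _ (cvg_cst 0) (@cvg_harmonic R)).
apply: nearW => i; rewrite ltW ?cut_gt0//= lef_pV2 ?posrE// ler_nat.
by rewrite -[i.+3]addn2 leq_addr.
Qed.

(** The limit of [beta_trunc_FTC]: the boundary terms tend to 0 because [a] and [b] are positive. *)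
Lemma euler_betaD1 (R : realType) (a b : R) : 0 < a -> 0 < b ->
  a * euler_beta a b = (a + b) * euler_beta (a + 1) b.
Proof.
move=> a0 b0; have a10 : 0 < a + 1 by lra.
apply/eqP; rewrite -subr_eq0; apply/eqP.
pose u i :=
  a * beta_trunc (cut R i) a b - (a + b) * beta_trunc (cut R i) (a + 1) b.
have cu : u i @[i --> \oo] -->
    a * euler_beta a b - (a + b) * euler_beta (a + 1) b.
  by apply: cvgB; apply: cvgM; (exact: cvg_cst || exact: cvg_beta_trunc).
have powc c : 0 < c -> cut R i `^ c @[i --> \oo] --> (0 : R).
  move=> c0; have /cvg_at_rightP := powR_cvg0 c0; apply; split; last exact: cvg_cut.
  by move=> i; exact: cut_gt0.
have vanish c d : 0 < c -> 0 < d ->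
    (1 - cut R i) `^ c * cut R i `^ d @[i --> \oo] --> (0 : R).
  move=> c0 d0; apply: (squeeze_cvgr _ (cvg_cst 0) (powc d d0)).
  apply: nearW => i; have := cut_gt0 R i; have := cut_lt R i => ? ?.
  by rewrite mulr_ge0 ?powR_ge0//= ler_piMl ?powR_ge0// powR_le1//; lra.
rewrite -(cvg_lim _ cu)//; apply/cvg_lim => //.
rewrite -[X in _ --> X](subrr 0).
under eq_cvg do rewrite /u beta_trunc_FTC ?cut_gt0 ?cut_lt// [X in _ - X]mulrC.
by apply: cvgB; exact: vanish.
Qed.

(** A nonnegative function of integral 0 vanishes almost everywhere, while the kernel is positive on
    a set of measure 1. *)
Lemma euler_beta_gt0 (R : realType) (a b : R) : 0 < a -> 0 < b ->
  0 < euler_beta a b.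
Proof.
move=> a0 b0; rewrite euler_beta_oo// lt_neqAle Rintegral_ge0 ?andbT//; last first.
  by move=> t _; exact: beta_kernel_ge0.
apply/eqP => /esym J0; have int := beta_kernel_integrable a0 b0.
have /measurable_EFinP mk := @measurable_beta_kernel R a b `]0, 1[%classic.
have [H _] := ae_eq_integral_abs (@lebesgue_measure R) (measurable_itv _) mk.
have [|N [mN N0 sN]] := H _.
  under eq_integral do rewrite /= ger0_norm ?beta_kernel_ge0//.
  by rewrite -[LHS]fineK ?integrable_fin_num//; congr EFin.
have : (lebesgue_measure `]0%R, 1%R[ <= lebesgue_measure N)%E.
  apply: le_measure; rewrite ?inE//; apply: subset_trans sN => t /= t01 /(_ t01) [].
  move: t01; rewrite in_itv/= => /andP[t0 t1] /eqP.
  by rewrite gt_eqF// mulr_gt0 ?powR_gt0// subr_gt0.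
by rewrite N0 lebesgue_measure_itv/= lte01 oppr0 adde0 lee_fin ler10.
Qed.

Lemma euler_beta_natD (R : realType) (a b : R) k : 0 < a -> 0 < b ->
  euler_beta (a + k%:R) b =
  (\prod_(i < k) ((a + i%:R) / (a + b + i%:R))) * euler_beta a b.
Proof.
move=> a0 b0; elim: k => [|k IH]; first by rewrite big_ord0 addr0 mul1r.
have ak : 0 < a + k%:R by rewrite ltr_wpDr.
have abk : 0 < a + b + k%:R by rewrite ltr_wpDr// addr_gt0.
rewrite big_ord_recr/= mulrAC -IH -natr1 addrA.
have := euler_betaD1 ak b0; rewrite [a + k%:R + b]addrAC => E.
by rewrite mulrA [euler_beta _ _ * _]mulrC E [RHS]mulrC mulKf// gt_eqF.
Qed.

Lemma euler_beta_monomial (R : realType) (a b : R) k : 0 < a -> 0 < b ->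
  lebesgue_measure.-integrable `]0, 1[
    (EFin \o (fun t => beta_kernel a b t * t ^+ k)) /\
  \int[lebesgue_measure]_(t in `]0, 1[) (beta_kernel a b t * t ^+ k) =
  euler_beta (a + k%:R) b.
Proof.
move=> a0 b0; have ak : 0 < a + k%:R by rewrite ltr_wpDr.
have kE t : t \in `]0, 1[%classic ->
    beta_kernel (a + k%:R) b t = beta_kernel a b t * t ^+ k.
  rewrite inE/= in_itv/= => /andP[t0 _].
  rewrite /beta_kernel mulrAC -powR_mulrn ?ltW// -powRD ?(gt_eqF t0) ?implybT//.
  by rewrite addrAC.
split; last by rewrite euler_beta_oo//; apply: eq_Rintegral => t /kE->.
apply: eq_integrable (beta_kernel_integrable ak b0) => // t /kE.
by rewrite /= => ->.
Qed.

(** Integrating term by term leaves the ratios [B(a + k, b) / B(a, b)] with [a = n x] and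
    [b = n (1 - x)]; as [a + b = n], these are the values of [rising] at [x]. *)
Lemma beta_opE (R : realType) n (q : {poly R}) (x : R) : (0 < n)%N ->
  0 <= x <= 1 -> beta_op n (horner q) x = (lin_ext (rising n%:R) q).[x].
Proof.
move=> n0 /andP[x0 x1]; have n0R : 0 < n%:R :> R by rewrite ltr0n.
have nk k : n%:R + k%:R != 0 :> R by rewrite gt_eqF// ltr_wpDr.
have TE y : (lin_ext (rising n%:R) q).[y] =
    \sum_(k < size q) q`_k * \prod_(i < k) ((n%:R * y + i%:R) / (n%:R + i%:R)).
  rewrite /lin_ext horner_sum; apply: eq_bigr => k _; rewrite hornerZ; congr (_ * _).
  elim: {k}(k : nat) => [|k IH]; first by rewrite big_ord0 hornerC.
  rewrite big_ord_recr/= hornerZ hornerM hornerD hornerZ hornerX hornerC IH.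
  by rewrite mulrC -mulrA mulrCA.
rewrite /beta_op TE; case: eqVneq => [->|xN0].
  (* At [x = 0] the factor of index 0 vanishes in every product with [k > 0]. *)
  rewrite horner_coef; apply: eq_bigr => k _; congr (_ * _).
  case: k => -[|k] kq /=; first by rewrite big_ord0.
  by rewrite big_ord_recl/= mulr0 addr0 mul0r mul0r exprS mul0r.
case: eqVneq => [->|xN1].
  rewrite horner_coef; apply: eq_bigr => k _; rewrite expr1n big1// => i _.
  by rewrite mulr1 divff.
have a0 : 0 < n%:R * x by rewrite mulr_gt0// lt_neqAle eq_sym xN0.
have b0 : 0 < n%:R * (1 - x) by rewrite mulr_gt0// subr_gt0 lt_neqAle xN1.
have B0 := euler_beta_gt0 a0 b0.
set a := n%:R * x; set b := n%:R * (1 - x).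
have -> : \int[lebesgue_measure]_(t in `[0, 1])
      (t `^ (a - 1) * (1 - t) `^ (b - 1) * q.[t]) =
    \int[lebesgue_measure]_(t in `]0, 1[)
      (\sum_(k < size q) q`_k * (beta_kernel a b t * t ^+ k)).
  rewrite /Rintegral (@integral_itv_bndoo _ _ _ _ true false); last first.
    apply/measurable_EFinP; apply: measurable_funM; first exact: measurable_beta_kernel.
    exact: measurable_poly.
  congr fine; apply: eq_integral => t _; congr EFin.
  rewrite horner_coef mulr_sumr; apply: eq_bigr => k _.
  by rewrite mulrCA.
(* Adding one term requires the rest to be integrable, so the induction carries both facts. *)
have sumE (r : seq nat) :
    lebesgue_measure.-integrable `]0, 1[
      (EFin \o (fun t => \sum_(k <- r) q`_k * (beta_kernel a b t * t ^+ k))) /\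
    \int[lebesgue_measure]_(t in `]0, 1[)
      (\sum_(k <- r) q`_k * (beta_kernel a b t * t ^+ k)) =
    \sum_(k <- r) q`_k * euler_beta (a + k%:R) b.
  elim: r => [|k r [IH1 IH2]].
    split; last first.
      rewrite big_nil (@eq_Rintegral _ _ _ _ _ (cst 0)) ?Rintegral_cst ?mul0r//.
      by move=> t _; rewrite big_nil.
    apply: eq_integrable (@integrable0 _ _ _ _ _) => // t _.
    by rewrite /= big_nil.
  have [m1 m2] := euler_beta_monomial k a0 b0.
  have m1' : lebesgue_measure.-integrable `]0, 1[
      (EFin \o (fun t => q`_k * (beta_kernel a b t * t ^+ k))).
    exact: eq_integrable (integrableZl _ q`_k m1).
  have E t : \sum_(j <- k :: r) q`_j * (beta_kernel a b t * t ^+ j) =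
      q`_k * (beta_kernel a b t * t ^+ k) +
      \sum_(j <- r) q`_j * (beta_kernel a b t * t ^+ j).
    by rewrite big_cons.
  split; first by apply: eq_integrable (integrableD _ m1' IH1) => // t _; rewrite /= E.
  under eq_Rintegral do rewrite E.
  rewrite RintegralD// RintegralZl//.
  by rewrite m2 IH2 big_cons.
have := (sumE (iota 0 (size q))).2.
under eq_Rintegral do rewrite -{1}[size q]subn0 -/(index_iota _ _) big_mkord.
move=> ->; rewrite -{1}[size q]subn0 -/(index_iota _ _) big_mkord mulr_sumr.
apply: eq_bigr => k _; rewrite euler_beta_natD// -[a + b]mulrDr addrC addrNK mulr1.
by rewrite [LHS]mulrC -mulrA; congr (_ * _); rewrite mulfK// gt_eqF.
Qed.

(** * Coefficientwise convergence *)

Lemma poly_eq_on_unit_interval (R : realType) (p q : {poly R}) :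
  (forall x, 0 <= x <= 1 -> p.[x] = q.[x]) -> p = q.
Proof.
move=> pq; apply/eqP; rewrite -subr_eq0; apply/eqP.
(* These are [size (p - q)] distinct points, more than the roots of a nonzero polynomial of that
   size. *)
pose rs := [seq (i.+1%:R^-1 : R) | i <- iota 0 (size (p - q))].
apply: (@roots_geq_poly_eq0 _ _ rs).
- apply/allP => _ /mapP[i _ ->]; rewrite rootE hornerD hornerN pq ?subrr//.
  by rewrite invr_ge0 ler0n/= invf_le1 ?ltr0n// ler1n.
- rewrite map_inj_uniq ?iota_uniq// => i j /invr_inj/eqP.
  by rewrite eqr_nat => /eqP[].
- by rewrite size_map size_iota.
Qed.

(** [lin_ext_risingK] provides a preimage and [lin_ext_momentK] its uniqueness. *)
Lemma beta_op_invE (R : realType) n (p : {poly R}) : (0 < n)%N ->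
  (size p <= n.+1)%N ->
  beta_op_inv n p = lin_ext (moment (- n%:R^-1)) p.
Proof.
move=> n0 sp; have n0R : 0 < n%:R :> R by rewrite ltr0n.
rewrite /beta_op_inv; apply: xget_subset1.
- split; first by apply: size_lin_ext => // k; exact: (size_moment_quot _ k).2.
  by move=> x x01; rewrite beta_opE// lin_ext_risingK.
- move=> q1 q2 [_ e1] [_ e2].
  apply: (can_inj (lin_ext_momentK n0R)); apply: poly_eq_on_unit_interval => x x01.
  by rewrite -!beta_opE// e1// e2.
Qed.

(** The common bound [N] keeps the sequence in a finite-dimensional space, so that uniform
    convergence on [[0, 1]] follows. *)
Definition coef_cvg (R : realType) N (u : nat -> {poly R}) (p : {poly R}) :=
  [/\ forall n, (size (u n) <= N)%N, (size p <= N)%N &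
    forall j, (u n)`_j @[n --> \oo] --> p`_j].

Lemma coef_cvg_cst (R : realType) N (p : {poly R}) :
  (size p <= N)%N -> coef_cvg N (fun=> p) p.
Proof. by move=> sp; split=> // j; exact: cvg_cst. Qed.

Lemma coef_cvgZ (R : realType) N (a : nat -> R) (b : R) u (p : {poly R}) :
  a @ \oo --> b -> coef_cvg N u p -> coef_cvg N (fun n => a n *: u n) (b *: p).
Proof.
move=> ab [su sp up]; split=> [n||j].
- exact: leq_trans (size_scale_leq _ _) (su n).
- exact: leq_trans (size_scale_leq _ _) sp.
- by rewrite coefZ; under eq_cvg do rewrite coefZ; exact: cvgM.
Qed.

Lemma coef_cvgD (R : realType) N u v (p q : {poly R}) :
  coef_cvg N u p -> coef_cvg N v q -> coef_cvg N (fun n => u n + v n) (p + q).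
Proof.
move=> [su sp up] [sv sq vq]; split=> [n||j].
- by rewrite (leq_trans (size_polyD _ _))// geq_max su sv.
- by rewrite (leq_trans (size_polyD _ _))// geq_max sp sq.
- by rewrite coefD; under eq_cvg do rewrite coefD; exact: cvgD.
Qed.

(** The coefficients are polynomials in [c], hence continuous. *)
Lemma cvg_moment (R : realType) (a : nat -> R) (b : R) k : a @ \oo --> b ->
  forall j, (moment_quot (a n) k)`_j @[n --> \oo] --> (moment_quot b k)`_j /\
  (moment (a n) k)`_j @[n --> \oo] --> (moment b k)`_j.
Proof.
move=> ab; elim: k => [|k IH] j; first by split=> /=; exact: cvg_cst.
have Q : (moment_quot (a n) k.+1)`_j @[n --> \oo] --> (moment_quot b k.+1)`_j.
  rewrite /= coefD coef_X1XM_deriv coefXM.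
  under eq_cvg do rewrite /= coefD coef_X1XM_deriv coefXM.
  apply: cvgD; first by case: (j == 0%N); [exact: cvg_cst|exact: (IH _).1].
  by apply: cvgB; apply: cvgMn; exact: (IH _).2.
split=> //; rewrite momentE coefD coefZ.
under eq_cvg do rewrite momentE coefD coefZ.
by apply: cvgD; [exact: cvg_cst|exact: cvgM].
Qed.

Lemma coef_cvg_moment_quot (R : realType) (a : nat -> R) (b : R) k :
  a @ \oo --> b ->
  coef_cvg k.+1 (fun n => moment_quot (a n) k) (moment_quot b k).
Proof.
move=> ab; split=> [n||j]; [exact: (size_moment_quot _ _).1..|].
exact: (cvg_moment k ab j).1.
Qed.

Lemma coef_cvg_moment (R : realType) (a : nat -> R) (b : R) k :
  a @ \oo --> b -> coef_cvg k.+1 (fun n => moment (a n) k) (moment b k).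
Proof.
move=> ab; split=> [n||j]; [exact: (size_moment_quot _ _).2..|].
exact: (cvg_moment k ab j).2.
Qed.

Lemma coef_cvg_lin_ext (R : realType) N (m : nat -> nat -> {poly R})
    (l : nat -> {poly R}) u (p : {poly R}) :
  (forall k, coef_cvg k.+1 (m^~ k) (l k)) -> coef_cvg N u p ->
  coef_cvg N (fun n => lin_ext (m n) (u n)) (lin_ext l p).
Proof.
move=> ml [su sp up]; split=> [n||j].
- by apply: size_lin_ext => // k; have [+ _ _] := ml k; apply.
- by apply: size_lin_ext => // k; have [] := ml k.
rewrite (lin_ext_wide _ sp) coef_sum.
under eq_cvg do rewrite (lin_ext_wide _ (su _)) coef_sum.
apply: (cvg_big add_continuous) => k _; rewrite coefZ; under eq_cvg do rewrite coefZ.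
by apply: cvgM => //; have [_ _] := ml k; apply.
Qed.

Lemma coef_cvg_peel (R : realType) N (a : nat -> R) (b : R) m u (p : {poly R}) :
  a @ \oo --> b -> coef_cvg N u p ->
  coef_cvg N (fun n => peel (a n) m (u n)) (peel b m p).
Proof.
move=> ab; elim: m u p => [|m IH] u p up //=; apply: IH.
rewrite -scaleNr; under [X in coef_cvg _ X _]eq_fun do rewrite -scaleNr.
apply: coef_cvgD; first by apply: coef_cvg_lin_ext => // k; exact: coef_cvg_moment_quot.
by apply: coef_cvgZ => //; apply: cvgN; exact: (cvg_moment m ab m).1.
Qed.

(** * Eigenvalues and eigenvectors as [c] tends to 0 *)

Lemma quot_lead0 (R : numDomainType) k :
  quot_lead (0 : R) k = - 'C(k, 2)%:R.
Proof.
elim: k => [|k IH]; first by rewrite /quot_lead coef0 oppr0.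
rewrite /quot_lead /= coefD coefXM /= coef_X1XM_deriv /= -/(quot_lead 0 k) IH.
rewrite momentE scale0r addr0 !coefXn eqxx binS bin1 natrD.
by rewrite (gtn_eqF (ltnSn k)) mul0rn opprD sub0r addrC.
Qed.

(** The condition [1 < k] excludes the one coincidence, between the indices 0 and 1. *)
Lemma quot_lead0_neq (R : numDomainType) j k : (j < k)%N -> (1 < k)%N ->
  quot_lead (0 : R) j != quot_lead 0 k.
Proof.
move=> jk k1; rewrite !quot_lead0 eqr_opp eqr_nat neq_ltn.
suff -> : ('C(j, 2) < 'C(k, 2))%N by [].
apply: (@leq_ltn_trans 'C(k.-1, 2)).
  by apply: leq_bin2l; rewrite -ltnS prednK// ltnW.
by case: k k1 {jk} => // -[|k]// _; rewrite binS bin1 -addn1 leq_add2l.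
Qed.

Lemma coef_cvg_eigenvec (R : realType) (a : nat -> R) k : (1 < k)%N ->
  a @ \oo --> (0 : R) ->
  coef_cvg k.+1 (fun n => eigenvec (a n) k) (eigenvec 0 k).
Proof.
move=> k1 a0; apply: coef_cvgZ; last first.
  by apply: coef_cvg_peel => //; apply: coef_cvg_cst; rewrite size_polyXn.
have ql j : (quot_lead (a n) j : R) @[n --> \oo] --> quot_lead (0 : R) j.
  exact: (cvg_moment j a0 j).1.
apply: cvgV.
  by apply/prodf_neq0 => j _; rewrite subr_eq0 eq_sym quot_lead0_neq.
by apply: (cvg_big mul_continuous) => j _; apply: cvgB.
Qed.

(** Powers of [x] are at most 1 on [[0, 1]], so the distance is at most a sum of [N] coefficient
    distances. *)
Lemma coef_cvg_uniform (R : realType) N u (p : {poly R}) : coef_cvg N u p ->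
  {uniform `[0, 1], (fun n => horner (u n)) @ \oo --> horner p}.
Proof.
move=> [su sp up] P /uniform_nbhs[E [entE EP]].
move: entE; rewrite -entourage_ballE => -[e /= e0 eE].
have S0 : \sum_(j < N) `|p`_j - (u n)`_j| @[n --> \oo] --> (0 : R).
  rewrite -[X in _ --> X](@big1 R 0 +%R 'I_N (index_enum _) predT (fun=> 0))//.
  apply: (@cvg_big R 'I_N +%R 0 predT add_continuous nat \oo (index_enum _)
    (fun j n => `|p`_j - (u n)`_j|) (fun=> 0)) => j _.
  have : (p`_j - (u n)`_j) @[n --> \oo] --> (p`_j - p`_j : R).
    by apply: cvgB (up j); exact: cvg_cst.
  by rewrite subrr => /cvg_norm; rewrite normr0.
have /cvgrPdist_lt/(_ e e0) := S0; apply: filterS => n /=.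
rewrite sub0r normrN ger0_norm ?sumr_ge0// => Sn.
apply: EP => x /=; rewrite in_itv/= => /andP[x0 x1]; apply: eE.
rewrite /ball/= (horner_coef_wide _ sp) (horner_coef_wide _ (su n)) -sumrB.
apply: le_lt_trans Sn; apply: le_trans (ler_norm_sum _ _ _) _.
apply: ler_sum => j _; rewrite -mulrBl normrM ler_piMr//.
by rewrite normrX exprn_ile1// ger0_norm.
Qed.

(** Two uniform limits agree at every point of [[0, 1]], hence as polynomials. Equality is asked for
    large [n] because [bernstein_eigenpoly] has its intended meaning for [k <= n]. *)
Lemma limit_eigenpolyE (R : realType) N k (p : {poly R}) u :
  coef_cvg N u p ->
  (\forall n \near \oo, bernstein_eigenpoly R n k = u n) ->
  limit_eigenpoly R k = p.
Proof.
move=> up eu; rewrite /limit_eigenpoly; apply: xget_subset1.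
  apply: cvg_trans (coef_cvg_uniform up); apply: near_eq_cvg.
  by apply: filterS eu => n ->.
have ptw (q : {poly R}) (x : R) : 0 <= x <= 1 ->
    {uniform `[0, 1], (fun n => horner (bernstein_eigenpoly R n k)) @ \oo
                        --> horner q} ->
    (bernstein_eigenpoly R n k).[x] @[n --> \oo] --> q.[x].
  move=> x01 qc.
  have x1 : [set x] `<=` `[0, 1] by move=> _ ->; rewrite /= in_itv.
  have := uniform_subset_cvg _ x1 qc; rewrite uniform_set1.
  by apply; exact: fmap_filter.
move=> q1 q2 h1 h2; apply: poly_eq_on_unit_interval => x x01.
have := ptw _ _ x01 h1; have := ptw _ _ x01 h2.
by move=> /(cvg_lim (@Rhausdorff R)) <- /(cvg_lim (@Rhausdorff R)) <-.
Qed.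

(** * Eigenpolynomials of the Bernstein operator *)

Lemma bernstein_lin_extE (R : realType) n (p : {poly R}) : (0 < n)%N ->
  bernstein n (horner p) = p + n%:R^-1 *: lin_ext (moment_quot n%:R^-1) p.
Proof. by move=> n0; rewrite bernsteinE// lin_ext_momentE. Qed.

Lemma bernstein_eigenval_quot_lead (R : realType) n k :
  (k <= n)%N -> (0 < n)%N ->
  bernstein_eigenval R n k = 1 + n%:R^-1 * quot_lead n%:R^-1 k.
Proof.
move=> kn n0; rewrite bernstein_eigenvalE// -coef_moment_lead momentE.
by rewrite coefD coefXn eqxx coefZ.
Qed.

(** As [B_n = 1 + L / n] with [1 / n] nonzero, its eigenvectors are those of [L]. *)
Lemma bernstein_eigenpolyE (R : realType) n k : (1 < k <= n)%N ->
  (forall j, (j < k)%N -> quot_lead (n%:R^-1 : R) j != quot_lead n%:R^-1 k) ->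
  bernstein_eigenpoly R n k = eigenvec n%:R^-1 k.
Proof.
move=> /andP[k1 kn] ne; have n0 : (0 < n)%N by apply: leq_trans kn; apply: ltnW.
have nV0 : n%:R^-1 != 0 :> R by rewrite invr_eq0 pnatr_eq0 -lt0n.
have [em es eL] := eigenvecP ne.
have bE (p : {poly R}) :
    bernstein n (horner p) = bernstein_eigenval R n k *: p <->
    lin_ext (moment_quot n%:R^-1) p = quot_lead n%:R^-1 k *: p.
  rewrite bernstein_lin_extE// bernstein_eigenval_quot_lead//.
  rewrite scalerDl scale1r -scalerA.
  by split=> [/addrI/(scalerI nV0)|->].
case: k k1 kn ne em es eL bE => [|[|k]]// _ kn ne em es eL bE.
rewrite /bernstein_eigenpoly; apply: xget_subset1; first by split=> //; apply/bE.
move=> p q [pm sp /bE Lp] [qm sq /bE Lq].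
exact: (eigenvec_unique ne).
Qed.

Lemma cvg_invn (R : realType) : n%:R^-1 @[n --> \oo] --> (0 : R).
Proof. by rewrite -(cvg_shiftS (fun n => n%:R^-1 : R)); exact: cvg_harmonic. Qed.

(** A common form for the explicit cases [k = 0, 1], with constant sequences, and the case [k >= 2].
    The eigenvalue is recorded for use with [F_op]. *)
Lemma bernstein_eigenpoly_asymptotics (R : realType) k :
  exists2 uq : (nat -> {poly R}) * {poly R}, coef_cvg k.+1 uq.1 uq.2 &
    \forall n \near \oo, bernstein_eigenpoly R n k = uq.1 n /\
      bernstein n (horner (uq.1 n)) =
        (1 + n%:R^-1 * quot_lead n%:R^-1 k) *: uq.1 n.
Proof.
(* [moment_quot] vanishes at the indices 0 and 1, so [B_n] fixes polynomials of degree at most 1. *)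
have lin (p : {poly R}) : (size p <= 2)%N -> \forall n \near \oo,
    bernstein n (horner p) = p.
  move=> sp; near=> n; have n0 : (0 < n)%N by near: n; exact: nbhs_infty_gt.
  rewrite bernstein_lin_extE// (lin_ext_wide _ sp) !big_ord_recl big_ord0 /=.
  by rewrite derivC !(mulr0, scaler0, addr0).
have q0 n : quot_lead (n%:R^-1 : R) 0 = 0 by rewrite /quot_lead coef0.
have q1 n : quot_lead (n%:R^-1 : R) 1 = 0.
  by rewrite /quot_lead /= derivC !mulr0 addr0 coef0.
case: k => [|[|k]].
- exists (fun=> 1, 1) => /=; first by apply: coef_cvg_cst; rewrite size_poly1.
  have := lin 1; rewrite size_poly1 => /(_ isT); apply: filterS => n ->.
  by rewrite q0 mulr0 addr0 scale1r.
- have s2 : size ('X - (2^-1)%:P : {poly R}) = 2 by rewrite size_XsubC.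
  exists (fun=> 'X - (2^-1)%:P, 'X - (2^-1)%:P) => /=.
    by apply: coef_cvg_cst; rewrite s2.
  have := lin ('X - (2^-1)%:P); rewrite s2 => /(_ isT); apply: filterS => n ->.
  by rewrite q1 mulr0 addr0 scale1r.
set K := k.+2; have a0 := @cvg_invn R.
exists ((fun n => eigenvec n%:R^-1 K), eigenvec 0 K) => /=.
  exact: coef_cvg_eigenvec.
(* Finitely many differences, each with a nonzero limit at [c = 0], are all nonzero for large
   [n]. *)
have ne : \forall n \near \oo, forall j, (j < K)%N ->
    quot_lead (n%:R^-1 : R) j != quot_lead n%:R^-1 K.
  have ne1 (j : 'I_K) : \forall n \near \oo,
      quot_lead (n%:R^-1 : R) j != quot_lead n%:R^-1 K.
    have cj : (quot_lead n%:R^-1 j - quot_lead n%:R^-1 K : R) @[n --> \oo] -->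
        (quot_lead 0 j - quot_lead 0 K : R).
      by apply: cvgB; exact: (cvg_moment _ a0 _).1.
    have := cvgr_neq0 _ cj; rewrite subr_eq0 quot_lead0_neq// => /(_ _ isT).
    by apply: filterS => n; rewrite subr_eq0.
  have /filter_forall := ne1; apply: filterS => n nen j jK.
  exact: (nen (Ordinal jK)).
near=> n; have nen : forall j, (j < K)%N ->
    quot_lead (n%:R^-1 : R) j != quot_lead n%:R^-1 K by near: n.
have Kn : (K <= n)%N by near: n; exact: nbhs_infty_ge.
have n0 : (0 < n)%N by apply: leq_trans Kn.
split; first by apply: (@bernstein_eigenpolyE R n K) => //; rewrite Kn.
have [_ _ eL] := eigenvecP nen.
by rewrite bernstein_lin_extE// eL scalerDl scale1r scalerA.
Unshelve. all: by end_near. Qed.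

Theorem mainTheorem10 (R : realType) (s : nat) :
  {uniform `[0, 1],
     (fun n : nat => horner (beta_op_inv n (bernstein_eigenpoly R n s))) @ \oo
       --> horner (limit_eigenpoly R s)} /\
  {uniform `[0, 1],
     (fun n : nat => horner (F_op n (horner (bernstein_eigenpoly R n s)))) @ \oo
       --> horner (limit_eigenpoly R s)}.
Proof.
have [[u q] /= uq eu] := bernstein_eigenpoly_asymptotics R s.
have -> : limit_eigenpoly R s = q.
  by apply: limit_eigenpolyE uq _; apply: filterS eu => n [].
have su n : (size (u n) <= s.+1)%N by have [+ _ _] := uq; apply.
(* At [c = 0] the moments are the monomials. *)
have S0 : lin_ext (moment 0) q = q by rewrite lin_ext_momentE scale0r addr0.
have Suq : coef_cvg s.+1 (fun n => lin_ext (moment (- n%:R^-1)) (u n)) q.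
  rewrite -S0; apply: coef_cvg_lin_ext => // k; apply: coef_cvg_moment.
  by rewrite -oppr0; apply: cvgN; exact: cvg_invn.
have l1 : 1 + n%:R^-1 * quot_lead n%:R^-1 s @[n --> \oo] --> (1 : R).
  rewrite -[X in _ --> X]addr0 -(mul0r (quot_lead (0 : R) s)).
  apply: cvgD; first exact: cvg_cst.
  by apply: cvgM; [exact: cvg_invn|exact: (cvg_moment _ (@cvg_invn R) _).1].
have := coef_cvgZ l1 Suq; rewrite scale1r => lSuq.
have eS : \forall n \near \oo,
    beta_op_inv n (bernstein_eigenpoly R n s) =
      lin_ext (moment (- n%:R^-1)) (u n) /\
    F_op n (horner (bernstein_eigenpoly R n s)) =
      (1 + n%:R^-1 * quot_lead n%:R^-1 s) *: lin_ext (moment (- n%:R^-1)) (u n).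
  (* For large [n] the eigenpolynomial is [u n], of degree at most [n], and [B_n] multiplies it by
     the eigenvalue, which then passes through the linear inverse. *)
  near=> n; have [-> bu] : bernstein_eigenpoly R n s = u n /\
      bernstein n (horner (u n)) = (1 + n%:R^-1 * quot_lead n%:R^-1 s) *: u n.
    by near: n.
  have n0 : (0 < n)%N by near: n; exact: nbhs_infty_gt.
  have sn : (s < n.+1)%N by near: n; exact: nbhs_infty_ge.
  have un : (size (u n) <= n.+1)%N by apply: leq_trans sn.
  rewrite /F_op bu !beta_op_invE ?lin_extZ//.
  exact: leq_trans (size_scale_leq _ _) un.
split.
  apply: cvg_trans (coef_cvg_uniform Suq); apply: near_eq_cvg.
  by apply: filterS eS => n [->].
apply: cvg_trans (coef_cvg_uniform lSuq); apply: near_eq_cvg.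
by apply: filterS eS => n [_ ->].
Unshelve. all: by end_near. Qed.
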